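(* Let $H$ be a finite simple graph with $\Delta(H)\le 2$, and let $G$ be obtained from $H$ by gluing in vertex-disjoint copies of $K_4$, i.e. there are pairwise disjoint $4$-element subsets $Y_1,\dots,Y_q\subseteq V(H)$ and $G$ has vertex set $V(H)$ and edge set $E(H)\cup\{uv: u\neq v,\ u,v\in Y_j \text{ for some } j\}$. Let $\mathcal{C}$ be the set of odd cycles of $H$ of length greater than $3$, and let $V(\mathcal{C})$ be the set of vertices lying on these cycles. Then there is a set $Z\subseteq V(\mathcal{C})$ with $|Z|\le |\mathcal{C}|/2$ such that $G-Z$ is $4$-colorable and $Z$ contains at most one vertex from each cycle of $\mathcal{C}$. Moreover, $|V(G)\setminus Z|\ge \tfrac{9}{10}|V(G)|$.
   Context: All graphs are finite and simple; the cycles of $H$ are its cycle components. *)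

(* Defs.v *)
From mathcomp Require Import all_boot.
Set Implicit Arguments. Unset Strict Implicit. Unset Printing Implicit Defensive.

Definition simple_graph (T : finType) (h : rel T) : Prop :=
  symmetric h /\ irreflexive h.

Definition deg (T : finType) (h : rel T) (x : T) : nat := #|[set y | h x y]|.

Definition maxdeg_le (T : finType) (h : rel T) (k : nat) : Prop :=
  forall x, deg h x <= k.

Definition comp (T : finType) (h : rel T) (x : T) : {set T} :=
  [set y | connect h x y].

Definition cycle_comps (T : finType) (h : rel T) : {set {set T}} :=
  [set C : {set T} | [exists x, C == comp h x] && [forall y in C, deg h y == 2]].

Definition long_odd_cycles (T : finType) (h : rel T) : {set {set T}} :=
  [set C in cycle_comps h | odd #|C| && (3 < #|C|)].

Definition cycles_vertices (T : finType) (S : {set {set T}}) : {set T} :=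
  \bigcup_(C in S) C.

Definition glue_K4 (T : finType) (h : rel T) (q : nat) (Y : 'I_q -> {set T}) : rel T :=
  fun u v => h u v || ((u != v) && [exists j, (u \in Y j) && (v \in Y j)]).

Definition colorable_minus (T : finType) (g : rel T) (Z : {set T}) (k : nat) : Prop :=
  exists f : T -> 'I_k, forall u v, u \notin Z -> v \notin Z -> g u v -> f u != f v.

(* Main.v *)
Require Import Defs.
From mathcomp Require Import all_boot.

(** Split every K_4 into two pairs, which gives an involution [rho], and look
    for a 2-colouring [f] that separates each pair and gives every vertex outside
    [Z] at most one [h]-neighbour of its own colour.  Each colour class then
    meets every K_4 in two vertices, so outside [Z] its graph is a union of two
    matchings, hence bipartite, and [G - Z] is 4-colourable.

    A vertex with an [h]-neighbour of the other colour is fine, and a path, an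
    even cycle or a triangle has a matching that settles all its vertices.  An
    odd cycle minus any vertex [z] has a perfect matching, so only [z] can fail.
    A component is eliminated by contracting its matching: replacing an edge [ab]
    by a pair made of the partners of [a] and [b] keeps an involution whose
    colourings extend.  By parity, every odd cycle has a vertex [z] that is
    unpaired or paired outside the cycle.  If [rho z] is not on another remaining
    long odd cycle, colouring [z] last settles it for free.  Otherwise miss both
    [z] and [rho z]: put [z] in [Z], and colour the two last so as to settle
    [rho z].  This costs one deletion for two cycles. *)

Set Implicit Arguments. Unset Strict Implicit. Unset Printing Implicit Defensive.

(** * Involutions as partial pairings, and colourings that separate their pairs *)

Section Alternating.
Variable T : finType.
Implicit Types (rho tau : T -> T) (f : T -> bool) (S : {set T}).

Definition alternating rho f := forall x, rho x != x -> f (rho x) != f x.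

Lemma alternating_exists rho : involutive rho -> exists f, alternating rho f.
Proof.
move=> inv; exists (fun x => enum_rank x < enum_rank (rho x)) => x neq.
rewrite inv; case: ltngtP => // /ord_inj/enum_rank_inj e.
by rewrite e eqxx in neq.
Qed.

(** The chain [rho a], [a], [b], [rho b] can alternate only if its two ends differ in colour. So
    [rho'] fixes [a] and [b] and pairs the ends with each other; an end whose counterpart is missing
    becomes a fixed point. *)
Lemma contract_edge rho a b : involutive rho -> a != b ->
  exists rho', involutive rho' /\
    forall f', alternating rho' f' -> exists f,
      [/\ alternating rho f, f a != f b &
          forall x, x != a -> x != b -> f x = f' x].
Proof.
move=> inv nab.
have injr := inv_inj inv.
have adj x y : (rho x == y) = (x == rho y) by rewrite -(inj_eq injr) inv.
(* If [a] and [b] are already partners, dropping their pair is enough. *)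
have [eab|neab] := eqVneq (rho a) b.
  have eba : rho b = a by rewrite -eab inv.
  exists (fun x => if (x == a) || (x == b) then x else rho x); split.
    move=> x; case: (boolP ((x == a) || (x == b))) => [-> //|nx].
    by rewrite !adj eab eba orbC (negPf nx) inv.
  move=> f' alt.
  exists (fun x => if x == a then true else if x == b then false else f' x).
  split; last by move=> x /negPf -> /negPf ->.
    move=> x; have [->|nxa] := eqVneq x a.
      by rewrite eab eqxx eq_sym (negPf nab).
    have [->|nxb] := eqVneq x b; first by rewrite eba eqxx.
    rewrite (adj x a) (adj x b) eab eba (negPf nxa) (negPf nxb).
    by have := alt x; rewrite (negPf nxa) (negPf nxb).
  by rewrite /= !eqxx [b == a]eq_sym (negPf nab).
have neba : rho b != a by rewrite adj eq_sym.
pose r x := if (x == a) || (x == b) then x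
            else if x == rho a then (if rho b == b then x else rho b)
            else if x == rho b then (if rho a == a then x else rho a)
            else rho x.
have nrab : rho a != rho b by rewrite (inj_eq injr).
exists r; split.
  move=> x; rewrite {2}/r.
  case: (boolP ((x == a) || (x == b))) => [h|]; first by rewrite /r h.
  rewrite negb_or => /andP[nxa nxb].
  have [xa|nxra] := eqVneq x (rho a).
    have [eb|nb] := eqVneq (rho b) b.
      by rewrite /r (negPf nxa) (negPf nxb) /= xa eqxx eb eqxx.
    rewrite /r (negPf neba) (negPf nb) /= eq_sym (negPf nrab) eqxx.
    by rewrite -xa (negPf nxa).
  have [xb|nxrb] := eqVneq x (rho b).
    have [ea|na] := eqVneq (rho a) a.
      by rewrite /r (negPf nxa) (negPf nxb) (negPf nxra) xb eqxx ea eqxx.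
    by rewrite /r (negPf na) (negPf neab) /= eqxx -xb (negPf nxb).
  by rewrite /r !adj (negPf nxra) (negPf nxrb) /= !inv (negPf nxa) (negPf nxb).
move=> f' alt.
(* [a] takes the colour opposite to its partner. When unpaired, it copies the colour of [rho b],
   because [b] will receive the opposite of [fa]. *)
pose fa := if rho a != a then ~~ f' (rho a) else if rho b != b then f' (rho b) else true.
have fbE : rho b != b -> ~~ fa = ~~ f' (rho b).
  rewrite /fa => nb; case: (boolP (rho a == a)) => [_|na] /=; first by rewrite nb.
  have := alt (rho a); rewrite /r (negPf na) (negPf neab) /= eqxx (negPf nb).
  rewrite eq_sym nrab => /(_ isT).
  by case: (f' (rho a)); case: (f' (rho b)).
exists (fun x => if x == a then fa else if x == b then ~~ fa else f' x); split.
- move=> x nx.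
  have [xa|nxa] := eqVneq x a.
    rewrite xa in nx *; rewrite (negPf nx) (negPf neab) /fa nx.
    by case: (f' _).
  have [xb|nxb] := eqVneq x b.
    rewrite xb in nx *; rewrite (negPf nx) (negPf neba) (fbE nx).
    by case: (f' _).
  have [xa|nxra] := eqVneq (rho x) a.
    have ea : rho a = x by rewrite -xa inv.
    have na : rho a != a by rewrite ea -xa eq_sym.
    by rewrite /fa na ea; case: (f' _).
  have [xb|nxrb] := eqVneq (rho x) b.
    have eb : rho b = x by rewrite -xb inv.
    have nb : rho b != b by rewrite eb -xb eq_sym.
    by rewrite (fbE nb) eb; case: (f' _).
  have := alt x; rewrite /r (negPf nxa) (negPf nxb) /= -!adj.
  by rewrite (negPf nxra) (negPf nxrb); apply.
- by rewrite /= !eqxx [b == a]eq_sym (negPf nab); case: (fa).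
by move=> x /negPf -> /negPf ->.
Qed.

(** The pairs of [tau] are contracted one at a time. Agreement of [f] and [f'] on the fixed points
    of [tau] is what lets the extensions be chained. *)
Lemma contract rho tau : involutive rho -> involutive tau ->
  exists rho', involutive rho' /\
    forall f', alternating rho' f' -> exists f,
      [/\ alternating rho f, alternating tau f &
          forall x, tau x = x -> f x = f' x].
Proof.
move=> inv invt; have [n le_n] := ubnP #|[set x | tau x != x]|.
elim: n => // n IH in rho tau inv invt le_n *.
have [a na|none] := pickP [pred x | tau x != x]; last first.
  have id_tau x : tau x = x by apply/eqP/negbFE/(none x).
  exists rho; split=> // f' alt.
  by exists f'; split=> // x; rewrite id_tau eqxx.
have nab : a != tau a by rewrite eq_sym.
have [r1 [inv1 ext1]] := contract_edge inv nab.
pose tau1 x := if (x == a) || (x == tau a) then x else tau x.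
have invt1 : involutive tau1.
  move=> x; rewrite {2}/tau1; case: ifP => [e|/norP[nxa nxb]]; first by rewrite /tau1 e.
  rewrite /tau1 (inj_eq (inv_inj invt)) -{1}[a]invt (inj_eq (inv_inj invt)).
  by rewrite (negPf nxa) (negPf nxb) invt.
have sub1 x : tau x = x -> tau1 x = x by rewrite /tau1 => ->; rewrite if_same.
have lt1 : #|[set x | tau1 x != x]| < n.
  rewrite ltnS in le_n; apply: leq_trans le_n; apply: proper_card; apply/properP; split.
    apply/subsetP => x; rewrite !inE; apply: contra => /eqP e.
    by rewrite sub1.
  by exists a; rewrite !inE // /tau1 !eqxx.
have [r2 [inv2 ext2]] := IH _ _ inv1 invt1 lt1.
exists r2; split=> // f' alt.
have [f1 [alt1 altt1 same1]] := ext2 _ alt.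
have [f [altf nf same]] := ext1 _ alt1.
exists f; split=> // x.
  have [->|nxa] := eqVneq x a; first by move=> _; rewrite eq_sym.
  have [->|nxb] := eqVneq x (tau a); first by rewrite invt.
  move=> nx; rewrite !same // ?(inj_eq (inv_inj invt)) //.
    by have := altt1 x; rewrite /tau1 (negPf nxa) (negPf nxb); apply.
  by rewrite -{1}[a]invt (inj_eq (inv_inj invt)).
move=> ex; rewrite same ?same1 ?sub1 //; apply: contraNneq na => e.
  by rewrite -e ex.
by rewrite -[X in _ == X]invt -e ex.
Qed.

(** The union of two matchings is bipartite: once [tau] is contracted, a single involution is left
    to alternate. *)
Lemma two_involutions rho tau : involutive rho -> involutive tau ->
  exists f, alternating rho f /\ alternating tau f.
Proof.
move=> inv invt; have [r [invr ext]] := contract inv invt.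
have [f' /ext[f [? ? _]]] := alternating_exists invr.
by exists f.
Qed.

(** Removing a pair of [rho] that lies inside [S] keeps the parity, so such pairs cannot exhaust
    [S]. *)
Lemma odd_involution rho S : involutive rho -> odd #|S| ->
  exists2 z, z \in S & rho z = z \/ rho z \notin S.
Proof.
move=> inv; have [n le_n] := ubnP #|S|; elim: n => // n IH in S le_n * => oddS.
have [z zS] : exists z, z \in S by apply/set0Pn; rewrite -card_gt0; case: #|S| oddS.
have [e|nz] := eqVneq (rho z) z; first by exists z; auto.
have [rS|] := boolP (rho z \in S); last by exists z; auto.
have cS : #|S| = #|S :\ z :\ rho z|.+2.
  by rewrite (cardsD1 z) zS (cardsD1 (rho z)) !inE nz rS.
rewrite cS /= negbK in oddS le_n.
have [|y] := IH _ _ oddS; first exact: ltnW.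
rewrite !inE => /and3P[nyr nyz yS] H; exists y => //.
case: H; [by left|rewrite !negb_and !negbK => /or3P[||]]; last by right.
  by rewrite (inj_eq (inv_inj inv)) (negPf nyz).
by rewrite -{1}[z]inv (inj_eq (inv_inj inv)) (negPf nyr).
Qed.

(** The default [x] turns unmatched vertices into fixed points. *)
Definition mate (m : rel T) x := odflt x [pick y | m x y].

Section Mate.
Variable m : rel T.
Hypotheses (m_sym : symmetric m) (m_irr : irreflexive m).
Hypothesis m_unique : forall x y z, m x y -> m x z -> y = z.

Lemma mateE x y : m x y -> mate m x = y.
Proof. by rewrite /mate => mxy; case: pickP => [z /m_unique/(_ mxy)//|/(_ y)/[!mxy]]. Qed.

Lemma mate_involutive : involutive (mate m).
Proof.
move=> x; have [y mxy|none] := pickP (m x).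
  by rewrite (mateE mxy); apply: mateE; rewrite m_sym.
suff e : mate m x = x by rewrite !e.
by rewrite /mate; case: pickP => // y; rewrite none.
Qed.

Lemma alternating_mate f x y : alternating (mate m) f -> m x y -> f x != f y.
Proof.
move=> alt mxy; rewrite eq_sym -(mateE mxy); apply: alt; rewrite (mateE mxy).
by apply: contraTneq mxy => ->; rewrite m_irr.
Qed.
End Mate.
End Alternating.

(** * Colouring a graph of maximum degree two, one component at a time *)

Section Core.
Variables (T : finType) (h : rel T).
Hypotheses (h_sym : symmetric h) (h_irr : irreflexive h) (h_deg : maxdeg_le h 2).
Implicit Types (rho tau : T -> T) (f : T -> bool) (S C : {set T}).
Implicit Types (D K : {set {set T}}).

Lemma nbr_cases x y z t : h x y -> h x z -> y != z -> h x t -> (t == y) || (t == z).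
Proof.
move=> xy xz nyz xt; apply: contraT => /norP[nty ntz].
have := h_deg x; rewrite /deg leqNgt => /negP[].
have <- : #|[set t; y; z]| = 3.
  by rewrite -setUA cardsU1 cards2 !inE negb_or nty ntz nyz.
by apply/subset_leq_card/subsetP => w; rewrite !inE => /orP[/orP[]|]/eqP->.
Qed.

(** Says that [x] is not the middle of a monochromatic path on three vertices, that is, at most one
    neighbour shares its colour. *)
Definition no_mono f x := forall y z, h x y -> h x z -> y != z ->
  f y = f x -> f z != f x.

Lemma no_mono_nbr f x y : h x y -> f y != f x -> no_mono f x.
Proof.
move=> xy ny a b xa xb nab fa; apply: contraNneq ny => fb.
by case/orP: (nbr_cases xa xb nab xy) => /eqP->; rewrite ?fa ?fb.
Qed.

Definition closed_set C := forall x y, x \in C -> h x y -> y \in C.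

Lemma no_mono_eq C f f' x : closed_set C -> x \in C -> {in C, f =1 f'} ->
  no_mono f' x -> no_mono f x.
Proof.
move=> clC xC e ok y z xy xz; have [yC zC] := (clC _ _ xC xy, clC _ _ xC xz).
by rewrite (e y yC) (e z zC) (e x xC); apply: ok.
Qed.

Definition matching tau S :=
  [/\ involutive tau, forall x, x \in S -> h x (tau x) &
      forall x, x \notin S -> tau x = x].

Lemma matching_neq tau S x : matching tau S -> (tau x != x) = (x \in S).
Proof.
case=> _ ht fixt; have [xS|nxS] := boolP (x \in S); last by rewrite fixt ?eqxx.
by apply: contraTneq (ht x xS) => ->; rewrite h_irr.
Qed.

Lemma matched_no_mono tau S f f' x : matching tau S -> alternating tau f' ->
  {in S, f =1 f'} -> x \in S -> no_mono f x.
Proof.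
move=> mt alt e xS; have [invt ht _] := mt.
have txS : tau x \in S by rewrite -(matching_neq _ mt) invt eq_sym (matching_neq _ mt).
apply: no_mono_nbr (ht x xS) _; rewrite (e _ txS) (e _ xS).
by apply: alt; rewrite (matching_neq _ mt).
Qed.

(** A component that costs no deletion: a vertex missed by the matching has its two neighbours
    matched to each other, as in a triangle, or has fewer than two, as at the end of a path. *)
Definition easy C := exists tau S, [/\ matching tau S, S \subset C &
  forall x, x \in C -> x \notin S ->
    forall y z, h x y -> h x z -> y != z -> tau y = z].

Definition factor_critical C :=
  odd #|C| /\ forall z, z \in C -> exists tau, matching tau (C :\ z).

Lemma contract_matching rho tau S : involutive rho -> matching tau S ->
  exists rho', involutive rho' /\
    forall f', alternating rho' f' -> exists f,
      [/\ alternating rho f, alternating tau f &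
          forall x, x \notin S -> f x = f' x].
Proof.
move=> inv mt; have [invt _ fixt] := mt.
have [r [invr ext]] := contract inv invt.
exists r; split=> // f' /ext[f [? ? same]]; exists f; split=> // x nx.
exact/same/fixt.
Qed.

(** The pair of [z] is removed from [rho] and coloured last: [z] against one of its neighbours, and
    [rho z], if distinct, against [z]. *)
Lemma isolate rho z : involutive rho ->
  exists rho', involutive rho' /\
    forall f', alternating rho' f' -> exists f,
      [/\ alternating rho f, no_mono f z &
          forall x, x != z -> x != rho z -> f x = f' x].
Proof.
move=> inv; have injr := inv_inj inv.
pose r x := if (x == z) || (x == rho z) then x else rho x.
have swap x : (rho x == z) || (rho x == rho z) = (x == z) || (x == rho z).
  by rewrite orbC (inj_eq injr) -{2}[z]inv (inj_eq injr).
exists r; split=> [x|f' alt].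
  by rewrite {2}/r; case: ifP => e; rewrite /r ?swap e ?inv.
(* The value [true] serves a vertex without neighbours. The chosen neighbour may be [rho z] itself,
   whose final colour [~~ c] differs from [c] in any case. *)
pose c := if [pick y | h z y] is Some y then ~~ f' y else true.
pose f x := if x == z then c else if x == rho z then ~~ c else f' x.
have frz : rho z != z -> f (rho z) = ~~ c by rewrite /f eqxx => /negPf ->.
have fz : f z = c by rewrite /f eqxx.
exists f; split; last by move=> x; rewrite /f => /negPf -> /negPf ->.
  move=> x nx; have [xz|nxz] := eqVneq x z.
    by rewrite xz fz frz -?xz //; case: (c).
  have [xr|nxr] := eqVneq x (rho z).
    rewrite xr inv fz frz; first by case: (c).
    by rewrite -xr.
  have := alt x; rewrite /r (negPf nxz) (negPf nxr) /= => /(_ nx).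
  have := swap x; rewrite (negPf nxz) (negPf nxr) => /norP[n1 n2].
  by rewrite /f (negPf nxz) (negPf nxr) (negPf n1) (negPf n2).
move: fz frz; rewrite /c; case: pickP => [y hzy|none] fz frz; last first.
  by move=> y y'; rewrite none.
apply: (no_mono_nbr hzy); rewrite fz.
have nyz : y != z by apply: contraTneq hzy => ->; rewrite h_irr.
have [e|ne] := eqVneq y (rho z).
  by rewrite {1}e frz -?e //; case: (f' y).
by rewrite /f (negPf nyz) (negPf ne); case: (f' y).
Qed.

Lemma trivIset_eq D C C' x : trivIset D -> C \in D -> C' \in D ->
  x \in C -> x \in C' -> C = C'.
Proof.
by move=> tr CD C'D xC xC'; rewrite -(def_pblock tr CD xC) (def_pblock tr C'D xC').
Qed.

Lemma notin_coverD1 D C x : trivIset D -> C \in D -> x \in cover (D :\ C) -> x \notin C.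
Proof.
move=> tr CD /bigcupP[C' /setD1P[ne C'D] xC']; apply: contra ne => xC.
by apply/eqP/(trivIset_eq tr C'D CD xC' xC).
Qed.

Lemma cover_setD1 D C x : x \in cover D -> x \in C \/ x \in cover (D :\ C).
Proof.
case/bigcupP=> C' C'D xC'; have [<-|ne] := eqVneq C' C; first by left.
by right; apply/bigcupP; exists C'; rewrite // !inE ne.
Qed.

Lemma coverS D D' : D \subset D' -> cover D \subset cover D'.
Proof.
by move/subsetP=> s; apply/bigcupsP => C /s CD; apply: (bigcup_sup C).
Qed.

Lemma no_mono_cover D f f' x : {in D, forall C, closed_set C} ->
  {in cover D, f =1 f'} -> x \in cover D -> no_mono f' x -> no_mono f x.
Proof.
move=> clD e /bigcupP[C CD xC]; apply: no_mono_eq (clD C CD) xC _ => y yC.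
by apply: e; apply/bigcupP; exists C.
Qed.

(** Strong induction on the number of cycles, since one or two are removed at a time, and for all
    [rho], since each contraction changes the involution. Colours are extended in the reverse order
    of the contractions. *)
Lemma factor_critical_coloring D :
  {in D, forall C, closed_set C} -> trivIset D ->
  {in D, forall C, factor_critical C} ->
  forall rho, involutive rho -> exists f (Z : {set T}),
  [/\ alternating rho f, Z \subset cover D, 2 * #|Z| <= #|D|,
      {in D, forall C, #|Z :&: C| <= 1} &
      {in cover D, forall x, x \notin Z -> no_mono f x}].
Proof.
have [n le_n] := ubnP #|D|; elim: n => // n IH in D le_n *.
move=> clD trD fcD rho inv; rewrite ltnS in le_n.
have {}IH D' : D' \proper D ->
  forall rho, involutive rho -> exists f (Z : {set T}),
  [/\ alternating rho f, Z \subset cover D', 2 * #|Z| <= #|D'|,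
      {in D', forall C, #|Z :&: C| <= 1} &
      {in cover D', forall x, x \notin Z -> no_mono f x}].
  move=> pD'; have /subsetP sub := proper_sub pD'; apply: IH.
  - exact: leq_trans (proper_card pD') le_n.
  - by move=> C /sub; apply: clD.
  - exact: trivIsetS (proper_sub pD') trD.
  - by move=> C /sub; apply: fcD.
have [D0|[C CD]] := set_0Vmem D.
  have [f alt] := alternating_exists inv.
  exists f, set0; rewrite cards0 muln0 sub0set; split=> // [C _|x].
    by rewrite set0I cards0.
  by rewrite D0 /cover big_set0 inE.
have clD1 : {in D :\ C, forall C', closed_set C'}.
  by move=> C' /setD1P[_]; apply: clD.
have [oddC /(_ _ _)crit] := fcD C CD.
have [z zC rz] := odd_involution inv oddC.
have [tau mtau] := crit z zC.
have nzCz : z \notin C :\ z by rewrite !inE eqxx.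
(* In the branch treated first, [rho z] is [z] itself or lies on no cycle of [D], so recolouring the
   pair disturbs no other vertex of these cycles. *)
have [rzD|rzD] := boolP ((rho z \notin C) && (rho z \in cover D)); last first.
  have rzE x : x \in cover D -> x != z -> x != rho z.
    move=> xD nxz; apply: contraNneq rzD => e; rewrite -e xD andbT.
    by case: rz; rewrite -e // => e'; rewrite e' eqxx in nxz.
  have [r1 [inv1 ext1]] := isolate z inv.
  have [r2 [inv2 ext2]] := contract_matching inv1 mtau.
  have [||f3 [Z [alt3 sZ cZ ZC ok3]]] := IH (D :\ C) _ r2 => //.
    exact: properD1.
  have [f2 [alt2 altt same2]] := ext2 _ alt3.
  have [f [alt okz same1]] := ext1 _ alt2.
  exists f, Z; split=> //.
  - exact: subset_trans sZ (coverS (subD1set _ _)).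
  - by apply: leq_trans cZ _; apply/subset_leq_card/subD1set.
  - move=> C' C'D; have [->|ne] := eqVneq C' C; last by apply: ZC; rewrite !inE ne.
    rewrite (_ : Z :&: C = set0) ?cards0 //; apply/setP => x; rewrite !inE.
    apply/negP => /andP[/(subsetP sZ)/(notin_coverD1 trD CD)/negPf -> //].
  - move=> x xD nxZ; case: (cover_setD1 C xD) => [xC|xD'].
      have [-> //|nxz] := eqVneq x z.
      have xS : x \in C :\ z by rewrite !inE nxz.
      apply: (matched_no_mono mtau altt _ xS) => y /setD1P[nyz yC].
      by apply: same1 => //; apply: rzE => //; apply/bigcupP; exists C.
    apply: (no_mono_cover clD1 _ xD' (ok3 x xD' nxZ)) => y yD'.
    have nyC := notin_coverD1 trD CD yD'.
    have nyz : y != z by apply: contraNneq nyC => ->.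
    rewrite same1 ?same2 //; first by rewrite !inE (negPf nyC) andbF.
    by apply: rzE => //; apply: subsetP yD'; apply/coverS/subD1set.
case/andP: rzD => nz'C /bigcupP[C' C'D z'C'].
have neC : C' != C by apply: contraNneq nz'C => <-.
have C'D1 : C' \in D :\ C by rewrite !inE neC.
have [_ /(_ _ z'C')[tau' mtau']] := fcD C' C'D.
have trD1 := trivIsetS (subD1set D C) trD.
have nCC' x : x \in C -> x \notin C'.
  by move=> xC; apply: contra neC => xC'; apply/eqP/(trivIset_eq trD C'D CD xC' xC).
(* The isolated vertex is [rho z], on the second cycle [C']. Its partner [z] is recoloured with it
   and deleted; the two matchings settle the rest of [C] and [C']. *)
have [r0 [inv0 ext0]] := isolate (rho z) inv.
have [r1 [inv1 ext1]] := contract_matching inv0 mtau'.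
have [r2 [inv2 ext2]] := contract_matching inv1 mtau.
have sD2 : D :\ C :\ C' \subset D by rewrite !(subset_trans (subD1set _ _)).
have [||f3 [Z [alt3 sZ cZ ZC ok3]]] := IH (D :\ C :\ C') _ r2 => //.
  by apply/properP; split=> //; exists C; rewrite // !inE eqxx andbF.
have [f2 [alt2 altt same2]] := ext2 _ alt3.
have [f1 [alt1 altt' same1]] := ext1 _ alt2.
have [f [alt okz same0]] := ext0 _ alt1.
rewrite inv in same0.
have nC' x : x \in cover (D :\ C :\ C') -> x \notin C'.
  exact: notin_coverD1 trD1 C'D1.
have nC x : x \in cover (D :\ C :\ C') -> x \notin C.
  by move/(subsetP (coverS (subD1set _ _))); apply: notin_coverD1 trD CD.
exists f, (z |: Z); split=> //.
- rewrite subUset sub1set (subset_trans sZ (coverS sD2)) andbT.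
  by apply/bigcupP; exists C.
- rewrite (cardsD1 C D) CD (cardsD1 C' (D :\ C)) C'D1 cardsU1 mulnDr.
  by rewrite addnA leq_add // (@leq_mul 2 _ 2 1) // leq_b1.
- move=> C2 C2D; have [->|ne] := eqVneq C2 C.
    rewrite -(cards1 z); apply/subset_leq_card/subsetP => x; rewrite !inE.
    by case/andP=> /orP[//|/(subsetP sZ)/nC/negPf ->].
  have [->|ne'] := eqVneq C2 C'.
    rewrite (_ : _ :&: _ = set0) ?cards0 //; apply/setP => x; rewrite !inE.
    apply/negP => /andP[/orP[/eqP->|/(subsetP sZ)/nC'/negPf -> //]].
    exact/negP/nCC'.
  apply: leq_trans (ZC C2 _); last by rewrite !inE ne ne'.
  apply/subset_leq_card/subsetP => x; rewrite !inE => /andP[/orP[/eqP->|-> //] zC2].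
  by rewrite (trivIset_eq trD C2D CD zC2 zC) eqxx in ne.
- move=> x xD; rewrite !inE negb_or => /andP[nxz nxZ].
  have [xC|/(cover_setD1 C')[xC'|xD']] := cover_setD1 C xD.
  + have xS : x \in C :\ z by rewrite !inE nxz.
    apply: (matched_no_mono mtau altt _ xS) => y /setD1P[nyz yC].
    rewrite same0 ?same1 ?inE ?(negPf (nCC' _ yC)) ?andbF //.
    by apply: contraNneq nz'C => <-.
  + have [-> //|nxz'] := eqVneq x (rho z).
    have xS : x \in C' :\ rho z by rewrite !inE nxz'.
    apply: (matched_no_mono mtau' altt' _ xS) => y /setD1P[nyz' yC'].
    by rewrite same0 //; apply: contraTneq yC' => ->; apply: nCC'.
  have clD2 : {in D :\ C :\ C', forall C', closed_set C'}.
    by move=> C2 /(subsetP sD2); apply: clD.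
  apply: (no_mono_cover clD2 _ xD' (ok3 x xD' nxZ)) => y yD'.
  rewrite same0 ?same1 ?same2 ?inE ?(negPf (nC _ yD')) ?(negPf (nC' _ yD')) ?andbF //.
    by apply: contraNneq (nC' _ yD') => ->.
  by apply: contraNneq (nC _ yD') => ->.
Qed.

(** Induction on the number of easy components, each contracted along its matching, until only the
    members of [D] remain. *)
Lemma separating_coloring D E :
  {in D :|: E, forall C, closed_set C} -> trivIset (D :|: E) ->
  [disjoint D & E] ->
  {in D, forall C, factor_critical C} -> {in E, forall C, easy C} ->
  forall rho, involutive rho -> exists f (Z : {set T}),
  [/\ alternating rho f, Z \subset cover D, 2 * #|Z| <= #|D|,
      {in D, forall C, #|Z :&: C| <= 1} &
      {in cover (D :|: E), forall x, x \notin Z -> no_mono f x}].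
Proof.
have [n le_n] := ubnP #|E|; elim: n => // n IH in E le_n *.
have [->|[C CE]] := set_0Vmem E.
  rewrite setU0 => clD trD _ fcD _; exact: factor_critical_coloring.
move=> clD trD dis fcD easyE rho inv; rewrite ltnS in le_n.
have CD : C \in D :|: E by rewrite inE CE orbT.
have DE1 : D :|: E :\ C = (D :|: E) :\ C.
  apply/setP => C'; rewrite !inE; have [->|] //= := eqVneq C' C.
  by rewrite orbF (disjointFl dis CE).
have [tau [S [mt sS cov]]] := easyE C CE.
have [r [invr ext]] := contract_matching inv mt.
have clD1 : {in D :|: E :\ C, forall C', closed_set C'}.
  by rewrite DE1 => C' /setD1P[_]; apply: clD.
have [||||f' [Z [alt' sZ cZ ZC ok']]] := IH (E :\ C) _ clD1 _ _ fcD _ r invr.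
- by apply: leq_trans le_n; rewrite [X in _ < X](cardsD1 C) CE.
- by rewrite DE1; apply: trivIsetS (subD1set _ _) trD.
- by apply: disjointWr dis; apply: subD1set.
- by move=> C' /setD1P[_]; apply: easyE.
have [f [alt altt same]] := ext _ alt'.
exists f, Z; split=> // x xD nxZ; have [xC|xD'] := cover_setD1 C xD.
  have [xS|nxS] := boolP (x \in S); first exact: matched_no_mono mt altt _ xS.
  (* The two neighbours of an unmatched vertex are partners under [tau], so they cannot both have
     its colour. *)
  move=> y z xy xz nyz <-; rewrite -(cov _ xC nxS _ _ xy xz nyz); apply: altt.
  by rewrite (cov _ xC nxS _ _ xy xz nyz) eq_sym.
rewrite -DE1 in xD'; apply: (no_mono_cover clD1 _ xD' (ok' x xD' nxZ)) => y.
rewrite DE1 => yD'; apply: same; apply: contra (notin_coverD1 trD CD yD').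
exact: (subsetP sS).
Qed.
End Core.

(* [all_boot] shadows [Defs.comp] by function composition. *)
Notation component := Defs.comp.

(** * Spanning paths and matchings in the components of [h] *)

Section Components.
Variables (T : finType) (h : rel T).
Hypotheses (h_sym : symmetric h) (h_irr : irreflexive h) (h_deg : maxdeg_le h 2).

(** Consecutive vertices are matched from the front. Applied to the relation of being distinct, this
    also pairs off the vertices of a clique. *)
Lemma path_matching s : uniq s -> ~~ odd (size s) -> sorted h s ->
  exists tau, matching h tau [set x in s].
Proof.
have [n le_n] := ubnP (size s); elim: n => // n IH in s le_n *.
case: s le_n => [|a [|b s]] //= le_n.
  by move=> _ _ _; exists id; split=> // x; rewrite inE.
rewrite negbK inE negb_or => /and3P[/andP[nab nas] nbs us] evs /andP[hab pbs].
have [||tau [inv ht fixt]] := IH s _ us evs; [exact: ltnW|exact: path_sorted pbs|].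
have ta : tau a = a by apply: fixt; rewrite inE.
have tb : tau b = b by apply: fixt; rewrite inE.
have nba : (b == a) = false by rewrite eq_sym (negPf nab).
exists (fun x => if x == a then b else if x == b then a else tau x); split=> x.
- have [->|nxa] := eqVneq x a; first by rewrite eqxx nba.
  have [->|nxb] := eqVneq x b; first by rewrite eqxx.
  have ntx c : tau c = c -> (tau x == c) = (x == c).
    by move=> tc; rewrite -{1}tc (inj_eq (inv_inj inv)).
  by rewrite !ntx // (negPf nxa) (negPf nxb) inv.
- rewrite !inE; have [-> //|nxa] := eqVneq x a.
  have [->|nxb] := eqVneq x b; first by rewrite h_sym.
  by move=> xs; apply: ht; rewrite inE.
rewrite !inE => /norP[/negPf -> /norP[/negPf -> nxs]].
by apply: fixt; rewrite inE.
Qed.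

(** A longest path from [z] spans the component, since a neighbour off the path would force too
    large a degree somewhere. The hypothesis covers an end of a path and any vertex of a cycle. *)
Lemma spanning_path z :
  deg h z <= 1 \/ (forall x, x \in component h z -> deg h x = 2) ->
  exists s, [/\ path h z s, uniq (z :: s) & component h z =i z :: s].
Proof.
move=> hz.
have three x a b c : uniq [:: a; b; c] -> h x a -> h x b -> h x c -> False.
  move=> u ha hb hc; have := h_deg x; rewrite /deg leqNgt => /negP[].
  rewrite -[3]/(size [:: a; b; c]) -(card_uniqP u); apply/subset_leq_card/subsetP => w.
  by rewrite !inE => /or3P[]/eqP->.
pose P n := [exists t : n.-tuple T, path h z t && uniq (z :: t)].
have exP : exists n, P n by exists 0; apply/existsP; exists [tuple].
have boundP n : P n -> n <= #|T|.
  case/existsP=> t /andP[_ u]; have := max_card (mem (z :: t)).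
  by rewrite (card_uniqP u) /= size_tuple; apply: ltnW.
case: (ex_maxnP exP boundP) => n /existsP[t /andP[pt ut]] maxn.
pose s := z :: t; exists (t : seq T); split=> //.
have sz : size s = n.+1 by rewrite /= size_tuple.
have last_nbr w : h (last z t) w -> w \in s.
  move=> hw; apply: contraT => nw.
  have /maxn : P n.+1.
    apply/existsP; exists [tuple of rcons t w].
    apply/andP; split; first by rewrite rcons_path pt.
    by rewrite -[z :: _]/(rcons s w) rcons_uniq nw.
  by rewrite ltnn.
have lastE : last z t = nth z s n by have := nth_last z s; rewrite sz => ->.
have step i : i < n -> h (nth z s i) (nth z s i.+1).
  by move=> lt_in; apply: (pathP z pt); rewrite size_tuple.
have step' i : 0 < i -> i <= n -> h (nth z s i) (nth z s i.-1).
  by case: i => // i _ lt_in; rewrite h_sym; apply: step.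
have nthE i j : i <= n -> j <= n -> (nth z s i == nth z s j) = (i == j).
  by move=> ? ?; rewrite nth_uniq ?sz ?ltnS.
have in_s w : w \in s -> exists2 i, i <= n & w = nth z s i.
  move=> ws; exists (index w s); last by rewrite nth_index.
  by rewrite -ltnS -sz index_mem.
have sub : {subset s <= component h z}.
  by move=> w ws; rewrite inE; apply: (path_connect pt).
have s0 : nth z s 0 = z by [].
have zs : z \in s by apply: mem_head.
have lasts : last z t \in s by apply: mem_last.
rewrite -/s; clearbody s.
have closed w u : w \in s -> h w u -> u \in s.
  move=> ws hwu; apply: contraT => nus.
  have [i le_in wE] := in_s w ws; rewrite {}wE in ws hwu.
  have nu j : j <= n -> u != nth z s j.
    by move=> le_jn; apply: contraNneq nus => ->; rewrite mem_nth ?sz.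
  have nin : i != n by apply: contraNneq nus => e; apply: last_nbr; rewrite lastE -e.
  have lt_in : i < n by rewrite ltn_neqAle nin.
  (* An inner vertex already has two neighbours on the path, so [u] would be a third; only the start
     [z] remains. *)
  case: (posnP i) => [i0|i_gt0]; last first.
    case: (three (nth z s i) (nth z s i.-1) (nth z s i.+1) u) => //; auto.
    have le_i1 : i.-1 <= n by apply: leq_trans (leq_pred _) _.
    rewrite /= !inE !negb_or nthE // ![_ == u]eq_sym !nu // !andbT.
    by rewrite -{2}(prednK i_gt0) neq_ltn ltnS leqnSn.
  rewrite i0 s0 in hwu lt_in ws.
  case: hz => [|all2].
    rewrite leqNgt => /negP[]; rewrite /deg.
    suff <- : #|[set u; nth z s 1]| = 2.
      apply/subset_leq_card/subsetP => x; rewrite !inE => /orP[]/eqP-> //.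
      by rewrite -{1}s0; apply: step.
    by rewrite cards2 nu.
  (* The last vertex has a second neighbour, which by maximality is on the path, at an index [j]
     below [n.-1]. That vertex then has a third neighbour: an inner vertex because of its path
     neighbours, and [z] because of [u]. *)
  have : deg h (last z t) = 2 by apply/all2/sub.
  have n1n : n.-1 <= n by apply: leq_pred.
  have hp : h (last z t) (nth z s n.-1) by rewrite lastE step'.
  rewrite /deg (cardsD1 (nth z s n.-1)) inE hp => -[] /eqP /cards1P[v vE].
  have /setD1P[nvp] : v \in [set y | h (last z t) y] :\ nth z s n.-1 by rewrite vE inE.
  rewrite inE => hlv; have [j le_jn ev] := in_s v (last_nbr v hlv).
  rewrite ev nthE // in nvp; rewrite lastE ev in hlv.
  have njn : j != n by apply: contraTneq hlv => ->; rewrite h_irr.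
  have lt_jn : j < n by rewrite ltn_neqAle njn.
  have nj1 : j.+1 != n by apply: contraNneq nvp => <-.
  rewrite h_sym in hlv.
  case: (posnP j) => [j0|j_gt0].
    case: (three z u (nth z s 1) (nth z s n)) => //; rewrite ?j0 //; last 2 first.
    - by rewrite -{1}s0; apply: step.
    - by rewrite j0 s0 in hlv.
    rewrite /= !inE negb_or !nu // nthE //= andbT.
    by rewrite j0 in nj1.
  case: (three (nth z s j) (nth z s j.-1) (nth z s j.+1) (nth z s n)) => //; auto.
  have le_j1 : j.-1 <= n by apply: leq_trans (leq_pred _) _.
  rewrite /= !inE !negb_or !nthE // nj1 !andbT; apply/andP; split.
    by rewrite -{2}(prednK j_gt0) neq_ltn ltnS leqnSn.
  by rewrite neq_ltn (leq_ltn_trans (leq_pred _) lt_jn).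
move=> w; apply/idP/idP => [|/sub //].
rewrite inE => /connectP[p]; elim/last_ind: p w => [|p x IHp] w /=.
  by move=> _ ->.
by rewrite rcons_path last_rcons => /andP[pp hx] ->; apply: closed hx; apply: IHp.
Qed.

Lemma comp_refl x : x \in component h x.
Proof. by rewrite inE connect0. Qed.

Lemma comp_eq x y : y \in component h x -> component h y = component h x.
Proof.
rewrite inE => xy; apply/setP => w; rewrite !inE.
by rewrite (same_connect (sym_connect_sym h_sym) xy).
Qed.

Lemma comp_closed x : closed_set h (component h x).
Proof. by move=> y z; rewrite !inE => xy /connect1; apply: connect_trans. Qed.

(** The spanning path from [z] is matched in consecutive pairs, starting after [z] when the order is
    odd. *)
Lemma comp_matching z :
  deg h z <= 1 \/ (forall x, x \in component h z -> deg h x = 2) ->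
  exists tau, matching h tau
    (if odd #|component h z| then component h z :\ z else component h z).
Proof.
case/spanning_path=> s [ps us cE].
have -> : #|component h z| = (size s).+1 by rewrite (eq_card cE) (card_uniqP us).
have [nzs us'] := andP us.
case: ifP => [/= ev|od].
  have [tau m] := path_matching us' ev (path_sorted ps); exists tau.
  suff -> : component h z :\ z = [set x in s] by [].
  apply/setP => x; rewrite in_setD1 cE !inE.
  by have [->|] := eqVneq x z; rewrite ?(negPf nzs).
have [tau m] := path_matching us (negbT od) ps; exists tau.
suff -> : component h z = [set x in z :: s] by [].
by apply/setP => x; rewrite cE !inE.
Qed.

(** On a cycle every vertex starts a spanning path, so any of them can be the one left out. *)
Lemma long_odd_factor_critical C :
  C \in long_odd_cycles h -> factor_critical h C.
Proof.
rewrite !inE => /andP[/andP[/existsP[x /eqP->] /'forall_implyP deg2] /andP[od _]].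
split=> // z zC; have e := comp_eq zC.
have [|tau] := @comp_matching z; last by rewrite e od; exists tau.
by right=> y; rewrite e => /deg2 /eqP.
Qed.

(** The path starts at a vertex of degree at most one if there is one. Only this start can be
    unmatched, and then it has at most one neighbour or the component is a triangle. *)
Lemma other_comp_easy x :
  component h x \notin long_odd_cycles h -> easy h (component h x).
Proof.
move=> nlong.
have [z [zC hz]] : exists z, z \in component h x /\
    (deg h z <= 1 \/ (forall y, y \in component h x -> deg h y = 2) ).
  have [/existsP[z /andP[zC dz]]|] := boolP [exists z in component h x, deg h z <= 1].
    by exists z; split; [|left].
  rewrite negb_exists => /forallP none; exists x; split; first exact: comp_refl.
  right=> y yC; apply/eqP; rewrite eqn_leq h_deg /= ltnNge.
  by have := none y; rewrite yC.
have e := comp_eq zC; rewrite -e in nlong hz *.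
have [tau mt] := comp_matching hz.
exists tau, (if odd #|component h z| then component h z :\ z else component h z).
split=> //.
  by case: ifP => // _; apply: subD1set.
move=> y yC; have [od|ev] := boolP (odd #|component h z|); last by rewrite yC.
rewrite od in mt.
rewrite !inE in yC *; rewrite yC andbT negbK => /eqP-> a b za zb nab.
case: hz => [|deg2].
  rewrite leqNgt => /negP[]; rewrite /deg.
  have <- : #|[set a; b]| = 2 by rewrite cards2 nab.
  by apply/subset_leq_card/subsetP => w; rewrite !inE => /orP[]/eqP->.
have c3 : #|component h z| <= 3.
  apply: contraNT nlong; rewrite -ltnNge => c4; rewrite !inE od c4 !andbT.
  apply/andP; split; first by apply/existsP; exists z.
  by apply/forallP => w; apply/implyP => /deg2 ->.
have [invt ht _] := mt.
have nza : a != z by apply: contraTneq za => ->; rewrite h_irr.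
have nzb : b != z by apply: contraTneq zb => ->; rewrite h_irr.
have aC : a \in component h z by apply: comp_closed za; apply: comp_refl.
have bC : b \in component h z by apply: comp_closed zb; apply: comp_refl.
have aS : a \in component h z :\ z by rewrite in_setD1 nza.
have nta : tau a != a by rewrite (matching_neq h_irr _ mt).
have : tau a \in component h z :\ z.
  by rewrite -(matching_neq h_irr _ mt) invt eq_sym.
(* If the partner of [a] were not [b], then [z], [a], [b] and [tau a] would be four vertices in a
   component of at most three. *)
case/setD1P=> ntz tC; apply/eqP; apply: contraTT c3 => ntb.
rewrite -ltnNge; have u : uniq [:: z; a; b; tau a].
  by rewrite /= !inE !negb_or ![z == _]eq_sym ![_ == tau a]eq_sym
             nza nzb ntz nab nta ntb.
rewrite -[4]/(size [:: z; a; b; tau a]) -(card_uniqP u).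
apply/subset_leq_card/subsetP => w; rewrite !inE.
by case/or4P=> /eqP->; move: aC bC tC; rewrite ?inE.
Qed.
End Components.

(** * The cliques: their pairing and the final 4-colouring *)

Section Pairing.
Variables (T : finType) (q : nat) (Y : 'I_q -> {set T}).
Hypothesis Y_disj : forall i j, i != j -> [disjoint Y i & Y j].

Lemma pairing_exists : (forall j, ~~ odd #|Y j|) -> exists sigma : T -> T,
  involutive sigma /\
  forall j x, x \in Y j -> sigma x \in Y j /\ sigma x != x.
Proof.
move=> evY; pose ne : rel T := fun x y => x != y.
have ne_irr : irreflexive ne by move=> x; rewrite /ne eqxx.
have ne_sym : symmetric ne by move=> x y; rewrite /ne eq_sym.
have pair j : exists tau, matching ne tau (Y j).
  have [|||tau] := @path_matching T ne ne_sym (enum (Y j)).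
  - exact: enum_uniq.
  - by rewrite -cardE.
  - by apply: pairwise_sorted; rewrite -uniq_pairwise enum_uniq.
  by exists tau; rewrite -[Y j]set_enum.
have [tau mt] := fin_all_exists pair.
have inY j x : x \in Y j -> [pick i | x \in Y i] = Some j.
  move=> xj; case: pickP => [i xi|/(_ j)/[!xj] //]; congr Some.
  by apply/eqP; apply: contraTT xi => /Y_disj /disjointFl ->.
have tauY j x : x \in Y j -> tau j x \in Y j.
  have [inv _ _] := mt j.
  by rewrite -!(matching_neq ne_irr _ (mt j)) inv eq_sym.
exists (fun x => if [pick j | x \in Y j] is Some j then tau j x else x).
split=> [x|j x xj]; last first.
  by rewrite (inY j x xj) (matching_neq ne_irr _ (mt j)) xj; split; first exact: tauY.
have [j xj|none] := pickP (fun j => x \in Y j).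
  by rewrite (inY j _ (tauY j x xj)); have [inv _ _] := mt j; apply: inv.
by case: pickP => // j; rewrite none.
Qed.

(** [sigma] injects the vertices of [Y j] coloured like [x] into those of the other colour, so each
    colour occurs at most twice among the four. *)
Lemma balanced_pairs sigma f j x y z : #|Y j| = 4 ->
  involutive sigma ->
  (forall j x, x \in Y j -> sigma x \in Y j /\ sigma x != x) ->
  alternating sigma f -> x \in Y j -> y \in Y j -> z \in Y j ->
  f y = f x -> f z = f x -> y != x -> z != x -> y = z.
Proof.
move=> Y4 inv pair alt xj yj zj fy fz nyx nzx; apply/eqP; apply: contraT => nyz.
pose A := [set w in Y j | f w == f x].
have le3 : 3 <= #|A|.
  have <- : #|[set x; y; z]| = 3.
    by rewrite setUC cardsU1 cards2 !inE negb_or ![z == _]eq_sym nyz eq_sym nzx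
      [x == y]eq_sym nyx.
  apply/subset_leq_card/subsetP => w; rewrite !inE.
  by case/orP=> [/orP[]|] /eqP->; rewrite ?xj ?yj ?zj ?fy ?fz eqxx.
have : #|sigma @: A| <= #|Y j :\: A|.
  apply/subset_leq_card/subsetP => _ /imsetP[w /setIdP[wj /eqP fw] ->].
  by have [sw nw] := pair j w wj; rewrite /A !inE sw andbT -fw alt.
rewrite card_imset; last exact: inv_inj.
have sA : A \subset Y j by apply/subsetP => w; rewrite inE => /andP[].
rewrite leqNgt => /negP[]; rewrite cardsD (setIidPr sA) Y4.
apply: (leq_trans _ le3); rewrite ltnS leq_subLR.
by rewrite (@leq_add 2 2) // ltnW.
Qed.
End Pairing.

(** Between vertices of equal [f]-colour, the edges of [h] off [Z] form one matching and the clique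
    edges another. A colouring [g] that separates both supplies the second bit of the colour. *)
Lemma colorable_minus_of_separating (T : finType) (h : rel T) (q : nat)
    (Y : 'I_q -> {set T}) (Z : {set T}) (sigma : T -> T) (f : T -> bool) :
  simple_graph h ->
  (forall j, #|Y j| = 4) ->
  (forall i j, i != j -> [disjoint Y i & Y j]) ->
  involutive sigma ->
  (forall j x, x \in Y j -> sigma x \in Y j /\ sigma x != x) ->
  alternating sigma f ->
  (forall x, x \notin Z -> no_mono h f x) ->
  colorable_minus (glue_K4 h Y) Z 4.
Proof.
move=> [h_sym h_irr] Y4 Y_disj inv pair alt ok.
pose mH x y := [&& h x y, f y == f x, x \notin Z & y \notin Z].
pose mY x y := [&& y != x, f y == f x & [exists j, (x \in Y j) && (y \in Y j)]].
have mH_sym : symmetric mH.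
  by move=> x y; rewrite /mH h_sym eq_sym [(x \notin Z) && _]andbC.
have mY_sym : symmetric mY.
  move=> x y; rewrite /mY eq_sym [f y == _]eq_sym; congr [&& _, _ & _].
  by apply: eq_existsb => j; rewrite andbC.
have mH_irr : irreflexive mH by move=> x; rewrite /mH h_irr.
have mY_irr : irreflexive mY by move=> x; rewrite /mY eqxx.
have mH_uniq x y z : mH x y -> mH x z -> y = z.
  move=> /and4P[xy /eqP fy nxZ _] /and4P[xz /eqP fz _ _].
  apply/eqP; apply: contraT => nyz.
  by have := ok x nxZ y z xy xz nyz fy; rewrite fz eqxx.
have mY_uniq x y z : mY x y -> mY x z -> y = z.
  move=> /and3P[nyx /eqP fy /existsP[j /andP[xj yj]]].
  move=> /and3P[nzx /eqP fz /existsP[i /andP[xi zi]]].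
  have eij : i = j.
    by apply/eqP; apply: contraTT xi => /Y_disj /disjointFl ->.
  rewrite eij in zi.
  exact: (balanced_pairs (Y4 j) inv pair alt xj yj zi fy fz nyx nzx).
have [g [altY altH]] :=
  two_involutions (mate_involutive mY_sym mY_uniq) (mate_involutive mH_sym mH_uniq).
pose c x : 'I_4 := inord ((f x).*2 + g x).
have cE x y : (c x == c y) = (f x == f y) && (g x == g y).
  by rewrite -val_eqE /= !inordK; case: (f x); case: (f y); case: (g x); case: (g y).
exists c => u v nuZ nvZ uv; rewrite cE; apply/negP => /andP[/eqP fuv /eqP guv].
have [huv|muv] : mH u v \/ mY u v.
- case/orP: uv => [huv|/andP[nuv ex]]; [left|right].
    by rewrite /mH huv fuv eqxx nuZ.
  by rewrite /mY eq_sym nuv fuv eqxx.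
- by have := alternating_mate mH_irr mH_uniq altH huv; rewrite guv eqxx.
by have := alternating_mate mY_irr mY_uniq altY muv; rewrite guv eqxx.
Qed.

Lemma components_trivIset (T : finType) (h : rel T) : symmetric h ->
  trivIset [set component h x | x : T].
Proof.
move=> h_sym; apply/trivIsetP => _ _ /imsetP[x _ ->] /imsetP[y _ ->].
apply: contraNT => /pred0Pn[z /= /andP[zx zy]].
by rewrite -(comp_eq h_sym zx) (comp_eq h_sym zy).
Qed.

Theorem theorem2p1 (T : finType) (h : rel T) (q : nat) (Y : 'I_q -> {set T}) :
  simple_graph h ->
  maxdeg_le h 2 ->
  (forall j, #|Y j| = 4) ->
  (forall i j, i != j -> [disjoint Y i & Y j]) ->
  exists Z : {set T},
    [/\ Z \subset cycles_vertices (long_odd_cycles h),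
        2 * #|Z| <= #|long_odd_cycles h|,
        colorable_minus (glue_K4 h Y) Z 4,
        (forall C, C \in long_odd_cycles h -> #|Z :&: C| <= 1) &
        9 * #|T| <= 10 * #|~: Z|].
Proof.
move=> simp h_deg Y4 Y_disj; have [h_sym h_irr] := simp.
pose D := long_odd_cycles h; pose comps := [set component h x | x : T].
have sD : D \subset comps.
  apply/subsetP => C; rewrite !inE => /andP[/andP[/existsP[x /eqP->] _] _].
  exact: imset_f.
have DE : D :|: comps :\: D = comps.
  by rewrite setDE setUIr setUCr setIT; apply/setUidPr.
have trC := components_trivIset h_sym.
have [sigma [inv pair]] : exists sigma : T -> T, involutive sigma /\
    forall j x, x \in Y j -> sigma x \in Y j /\ sigma x != x.
  by apply: pairing_exists => // j; rewrite Y4.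
have [|||||f [Z [alt sZ cZ ZC ok]]] :=
  @separating_coloring T h h_irr h_deg D (comps :\: D) _ _ _ _ _ sigma inv.
- by rewrite DE => _ /imsetP[x _ ->]; apply: comp_closed.
- by rewrite DE.
- by rewrite disjoint_sym disjoints_subset setDE subsetIr.
- exact: long_odd_factor_critical.
- move=> C /setDP[/imsetP[x _ ->]]; exact: other_comp_easy.
exists Z; split=> //.
  apply: (colorable_minus_of_separating simp Y4 Y_disj inv pair alt) => x.
  apply: ok; rewrite DE; apply/bigcupP; exists (component h x); last exact: comp_refl.
  exact: imset_f.
(* An odd length above 3 is at least 5, and distinct components are disjoint. With two cycles per
   deleted vertex, at most a tenth of the vertices is deleted. *)
have le5 : 5 * #|D| <= #|T|.
  apply: leq_trans (max_card (cover D)).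
  have /eqP <- := trivIsetS sD trC; rewrite mulnC -sum_nat_const.
  apply: leq_sum => C; rewrite !inE => /and3P[_ od]; rewrite leq_eqVlt => /orP[|//].
  by move/eqP=> e; rewrite -e in od.
have : 10 * #|Z| <= #|T| by apply: leq_trans le5; rewrite -[10]/(5 * 2) -mulnA leq_mul2l.
by rewrite -(cardsC Z) mulSn leq_add2l mulnDr [10 * #|~: Z|]mulSn leq_add2r.
Qed.
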